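(* If $P$ is a finite poset that contains the standard example $S_5$ as a subposet, then the cover graph of $P$ has treewidth at least $3$.
   Context: The standard example $S_n$ is the poset on $\{a_1,\dots,a_n,b_1,\dots,b_n\}$ in which $a_i<b_j$ iff $i\neq j$, with no other strict relations (equivalently, the subposet of subsets of $\{1,\dots,n\}$ formed by the singletons and the $(n-1)$-element sets, ordered by inclusion). $P$ contains $S_5$ as a subposet means some subset of $P$ with the induced order is isomorphic to $S_5$. The cover graph of $P$ is the graph on the elements of $P$ with $x,y$ adjacent iff one covers the other ($x<y$ with no $z$ satisfying $x<z<y$). A tree-decomposition of a graph $G=(V,E)$ is a tree $T$ with bags $V_t\subseteq V$ ($t\in V(T)$) such that the bags cover $V$, every edge lies in some bag, and $V_{t_1}\cap V_{t_3}\subseteq V_{t_2}$ whenever $t_2$ lies on the $t_1$–$t_3$ path in $T$; its width is $\max_t|V_t|-1$, and the treewidth is the minimum width of a tree-decomposition. *)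

(* Defs.v *)
From HB Require Import structures.
From mathcomp Require Import all_boot all_order.
From mathcomp Require Import boolp.

Set Implicit Arguments.
Unset Strict Implicit.
Unset Printing Implicit Defensive.

Import Order.TTheory.

(* S_n: [inl i] is a_i, [inr i] is b_i, and a_i < b_j iff i != j. *)
Definition std_example (n : nat) : Type := ('I_n + 'I_n)%type.

HB.instance Definition _ (n : nat) := Finite.on (std_example n).

Definition std_lt (n : nat) (x y : std_example n) : bool :=
  match x, y with
  | inl i, inr j => i != j
  | _, _ => false
  end.

Fact std_lt_irr (n : nat) : irreflexive (@std_lt n).
Proof. by case. Qed.

Fact std_lt_trans (n : nat) : transitive (@std_lt n).
Proof. by move=> [y|y] [x|x] [z|z]. Qed.

Fact std_display : Order.disp_t.
Proof. exact: Order.Disp tt tt. Qed.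

HB.instance Definition _ (n : nat) :=
  @Order.Lt_isPOrder.Build std_display (std_example n)
    (@std_lt n) (@std_lt_irr n) (@std_lt_trans n).

Definition contains_subposet (dP dQ : Order.disp_t) (P : finPOrderType dP)
    (Q : porderType dQ) : Prop :=
  exists (A : {set P}) (f : Q -> {x : P | x \in A}),
    bijective f /\
    forall x y : Q, (val (f x) <= val (f y))%O = (x <= y)%O.

Definition covers (d : Order.disp_t) (P : finPOrderType d) (y x : P) : bool :=
  (x < y)%O && ~~ [exists z : P, (x < z)%O && (z < y)%O].

Definition cover_graph (d : Order.disp_t) (P : finPOrderType d) : rel P :=
  [rel x y | covers x y || covers y x].

Arguments cover_graph {d} P.

(* In a symmetric graph, [ucycle adj] also holds of duplicate-free sequences of
   length at most 2 (such as both ends of an edge); the genuine cycles are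
   those of length at least 3. *)
Record is_tree (N : finType) (adj : rel N) : Prop := IsTree {
  tree_nonempty : 0 < #|N|;
  tree_sym : symmetric adj;
  tree_irr : irreflexive adj;
  tree_connected : forall s t : N, connect adj s t;
  tree_acyclic : forall c : seq N, ucycle adj c -> size c <= 2
}.

Record tree_decomposition (V : finType) (e : rel V) := TreeDecomposition {
  td_node : finType;
  td_adj : rel td_node;
  td_bag : td_node -> {set V};
  td_tree : is_tree td_adj;
  td_vertex : forall v : V, exists t, v \in td_bag t;
  td_edge : forall u v : V, e u v ->
    exists t, (u \in td_bag t) && (v \in td_bag t);
  (* [t1 :: p] is the path from [t1] to [last t1 p] in the tree. *)
  td_path : forall (t1 : td_node) (p : seq td_node),
    path td_adj t1 p -> uniq (t1 :: p) ->
    forall t2, t2 \in t1 :: p ->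
      td_bag t1 :&: td_bag (last t1 p) \subset td_bag t2
}.

Arguments td_adj {V e} D : rename.
Arguments td_bag {V e} D t : rename.

(* The predecessor is truncated, which matters only if [V] is empty: the width
   is then 0 rather than -1. *)
Definition width (V : finType) (e : rel V) (D : tree_decomposition e) : nat :=
  (\max_(t : td_node D) #|td_bag D t|).-1.

Section TrivialDecomposition.
Variables (V : finType) (e : rel V).

Let adj : rel unit := [rel _ _ | false].
Let bag (_ : unit) : {set V} := [set: V].

Fact trivial_tree : is_tree adj.
Proof.
split=> //; first by rewrite card_unit.
- by case=> [[]]; apply: connect0.
- by case=> [|x [|y c]] //= /andP[].
Qed.

Fact trivial_vertex (v : V) : exists t, v \in bag t.
Proof. by exists tt; rewrite inE. Qed.

Fact trivial_edge (u v : V) : e u v ->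
  exists t, (u \in bag t) && (v \in bag t).
Proof. by exists tt; rewrite !inE. Qed.

Fact trivial_path (t1 : unit) (p : seq unit) :
  path adj t1 p -> uniq (t1 :: p) ->
  forall t2, t2 \in t1 :: p -> bag t1 :&: bag (last t1 p) \subset bag t2.
Proof. by move=> _ _ t2 _; apply: subsetT. Qed.

Definition trivial_decomposition : tree_decomposition e :=
  TreeDecomposition trivial_tree trivial_vertex trivial_edge trivial_path.
End TrivialDecomposition.

Definition has_width (V : finType) (e : rel V) (k : nat) : bool :=
  `[< exists D : tree_decomposition e, width D = k >].

Fact has_width_ex (V : finType) (e : rel V) : exists k, has_width e k.
Proof.
by exists (width (trivial_decomposition e)); apply/asboolP; eexists.
Qed.

Definition treewidth (V : finType) (e : rel V) : nat :=
  ex_minn (has_width_ex e).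

(* Main.v *)
(* If the cover graph has width at most 2, consider the connected vertex sets
   containing both [a_i] and [b_i] for at least three of the five indices. Any two
   of them share an index, so by the Helly property of subtrees some bag [Z], with
   at most three elements, meets them all.

   Every component [K] of the complement of [Z] has at most two neighbours in [Z]:
   otherwise these and [K] would pairwise touch, and a bag would contain three
   neighbours and an element of [K]. A chain leaving [K] passes through such a
   neighbour, and two elements cannot carry all the relations [a_i < b_j] between
   [K] and the outside unless [K] touches at most two indices.

   Let [m i] be the set of elements above [a_i]. If [m i] is included in [m j] on
   [Z], then no chain from [a_i] to [b_j] meets [Z], so both ends lie in one
   component, while the neighbours of this component tell [m i] and [m j] apart
   from the three other sets. Five sets and at most three elements leave no room
   for this. *)
Require Import Defs.
From mathcomp Require Import all_boot all_order.
From mathcomp Require Import boolp zify.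

Set Implicit Arguments.
Unset Strict Implicit.
Unset Printing Implicit Defensive.

Import Order.TTheory.

(** * Trees with one node deleted *)

Definition del_node (N : finType) (adj : rel N) (x : N) : rel N :=
  [rel u v | [&& adj u v, u != x & v != x]].

Lemma connect_del_node (N : finType) (adj : rel N) (x u : N) (p : seq N) :
  path adj u p -> x \notin u :: p -> connect (del_node adj x) u (last u p).
Proof.
elim: p u => [|v p IHp] u /=; first by rewrite connect0.
case/andP=> uv pv; rewrite !inE !negb_or => /and3P[xu xv xp].
apply: connect_trans (IHp v pv _); last by rewrite inE negb_or xv.
by apply: connect1; rewrite /del_node /= uv eq_sym xu eq_sym xv.
Qed.

Lemma connect_first_step (N : finType) (adj : rel N) (x u : N) :
  connect adj x u -> x != u ->
  exists2 y, adj x y & connect (del_node adj x) y u.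
Proof.
case/connectP=> p /shortenP[[|y q] /=]; first by move=> _ _ _ ->; rewrite eqxx.
case/andP=> xy yq /andP[xq _] _ -> _.
by exists y => //; apply: connect_del_node yq xq.
Qed.

(** Otherwise a path from [y] to [y'] avoiding [x] closes up through [x] to a cycle of length at
    least 3. *)
Lemma tree_neighbour_eq (N : finType) (adj : rel N) (x y y' : N) :
  is_tree adj -> adj x y -> adj x y' -> connect (del_node adj x) y y' -> y = y'.
Proof.
move=> treeT xy xy' /connectP[p /shortenP[q yq Uq _ eq_y']].
have yNx : y != x by apply: contraTneq xy => ->; rewrite (tree_irr treeT).
have xq : x \notin y :: q.
  elim: q y yq yNx {xy eq_y' Uq} => [|z q IHq] y /=.
    by rewrite inE eq_sym => _ ->.
  case/andP=> /and3P[_ yx zx] zq _; rewrite inE negb_or eq_sym yx /=.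
  exact: IHq.
have cyc : ucycle adj (x :: y :: q).
  rewrite /ucycle cons_uniq xq Uq andbT /= xy rcons_path -eq_y'.
  rewrite (tree_sym treeT) xy' !andbT /=.
  by apply: sub_path yq => u v /and3P[].
by move/(tree_acyclic treeT): cyc eq_y'; case: q {yq Uq xq}.
Qed.

(** * Connected vertex sets and the Helly property *)

Definition connected_in (V : finType) (e : rel V) (C : {set V}) : bool :=
  [forall x in C, forall y in C,
     connect [rel u v | [&& e u v, u \in C & v \in C]] x y].

Lemma connected_inP (V : finType) (e : rel V) (C : {set V}) :
  reflect {in C &, forall x y,
             connect [rel u v | [&& e u v, u \in C & v \in C]] x y}
          (connected_in e C).
Proof.
apply: (iffP forall_inP) => [H x y xC yC | H x xC].
  exact: (forall_inP (H x xC)).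
by apply/forall_inP=> y; apply: H.
Qed.

Lemma connected_in_set1 (V : finType) (e : rel V) (x : V) :
  connected_in e [set x].
Proof. by apply/connected_inP=> u v /set1P-> /set1P->; apply: connect0. Qed.

(** Two bags sharing a vertex of [C] are joined by a tree path avoiding [x]. Adjacent vertices of
    [C] share a bag, so such paths concatenate along a walk in [C]. *)
Lemma connected_nodes (V : finType) (e : rel V) (D : tree_decomposition e)
    (C : {set V}) (x u u' : td_node D) :
  connected_in e C -> [disjoint td_bag D x & C] ->
  ~~ [disjoint td_bag D u & C] -> ~~ [disjoint td_bag D u' & C] ->
  connect (del_node (td_adj D) x) u u'.
Proof.
move=> /connected_inP connC xC /pred0Pn[v /andP[/= vu vC]].
case/pred0Pn=> w /andP[/= wu' wC].
have share z s s' : z \in C -> z \in td_bag D s -> z \in td_bag D s' ->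
    connect (del_node (td_adj D) x) s s'.
  move=> zC zs zs'; have /connectP[p] := tree_connected (td_tree D) s s'.
  case/shortenP=> q sq Uq _ eq_s'; rewrite eq_s'.
  apply: connect_del_node => //; apply/negP=> xq.
  have /subsetP/(_ z) := td_path sq Uq xq.
  rewrite -eq_s' inE zs zs' => /(_ isT) zx.
  by move/disjointFr: xC => /(_ z zx); rewrite zC.
have /connectP[p] := connC _ _ vC wC.
elim: p v vC u vu => [|z p IHp] v vC u vu /=.
  by move=> _ eq_w; apply: (share v) => //; rewrite -eq_w.
case/andP=> /and3P[vz _ zC] zp eq_w.
have [s /andP[vs zs]] := td_edge D vz.
exact: connect_trans (share v _ _ vC vu vs) (IHp z zC s zs zp eq_w).
Qed.

(* If every node [t] missed some member of [F], that member would lie behind a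
   single neighbour [f t] of [t]. Since a tree has no cycle, [f] has an orbit of
   length 2, and the members missed at its two ends lie on opposite sides of an
   edge of the tree. *)
Lemma tree_decomposition_helly (V : finType) (e : rel V)
    (D : tree_decomposition e) (F : {set {set V}}) :
  {in F, forall C : {set V}, connected_in e C} ->
  {in F &, forall C C' : {set V}, exists t,
     ~~ [disjoint td_bag D t & C] && ~~ [disjoint td_bag D t & C']} ->
  exists t, {in F, forall C : {set V}, ~~ [disjoint td_bag D t & C]}.
Proof.
move=> connF touchF; have treeT := td_tree D.
case: (boolP [exists t, [forall C in F, ~~ [disjoint td_bag D t & C]]]).
  by case/existsP=> t /forall_inP Ht; exists t.
rewrite negb_exists => /forallP noT; exfalso.
have missed t : exists y, td_adj D t y /\ exists C : {set V},
    [/\ C \in F, [disjoint td_bag D t & C] & forall u,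
      ~~ [disjoint td_bag D u & C] -> connect (del_node (td_adj D) t) y u].
  have := noT t; rewrite negb_forall_in => /exists_inP[C CF]; rewrite negbK => tC.
  have [u /andP[uC _]] := touchF C C CF CF.
  have tu : t != u by apply: contraNneq uC => <-.
  have [y ty yu] := connect_first_step (tree_connected treeT t u) tu.
  exists y; split=> //; exists C; split=> // w wC.
  exact: connect_trans yu (connected_nodes (connF C CF) tC uC wC).
have [f fP] := choice missed.
have [x [y [xy fx fy]]] : exists x y, [/\ td_adj D x y, f x = y & f y = x].
  have /card_gt0P[t0 _] := tree_nonempty treeT.
  have /loopingP/(_ (order f t0))/trajectP[i ltin eq_i] := looping_order f t0.
  pose x := iter i f t0.
  have cyc : fcycle f (orbit f x).
    (* Items 3 and 0 of the equivalence: a positive iterate of [f] fixes [x], so the orbit of [x] is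
       an [f]-cycle. *)
    apply/(orbitPcycle 3 0); exists (order f t0 - i).-1.
    by rewrite prednK ?subn_gt0 // /x -iterD subnK ?(ltnW ltin).
  have ff : f (f x) = x.
    have /(tree_acyclic treeT) : ucycle (td_adj D) (orbit f x).
      rewrite /ucycle orbit_uniq andbT.
      by apply: sub_cycle cyc => u v /eqP<-; case: (fP u).
    rewrite size_orbit => le2.
    have := (orbitPcycle 0 4).1 cyc.
    have fxNx : f x != x.
      apply/eqP => fx; have [] := fP x; by rewrite fx (tree_irr treeT).
    by case: (order f x) (order_gt0 f x) le2 => [|[|[|]]] //= _ _ /eqP;
      rewrite (negPf fxNx).
  by exists x, (f x); split=> //; case: (fP x).
have [_ [A [AF xA behindA]]] := fP x; have [_ [B [BF yB behindB]]] := fP y.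
have [u /andP[uA uB]] := touchF A B AF BF.
have yu := behindA u uA; have xu := behindB u uB.
rewrite fx in yu; rewrite fy in xu.
have xNu : x != u by apply: contraTneq uA => <-; rewrite xA.
(* Both [y] and [z] reach [u] without passing [x], so these two neighbours of [x] would coincide. *)
have [z /and3P[/= xz _ zNy] zu] := connect_first_step xu xNu.
have del_sym : connect_sym (del_node (td_adj D) x).
  apply: sym_connect_sym => v w.
  by rewrite /del_node /= (tree_sym treeT) (andbC (v != x)).
suff /eqP : y = z by rewrite eq_sym (negPf zNy).
apply: tree_neighbour_eq treeT xy xz _.
apply: connect_trans yu _; rewrite del_sym.
apply: connect_sub zu => v w /and3P[/and3P[vw _ _] vx wx].
by apply: connect1; apply/and3P.
Qed.

(** * Chains crossing a vertex set *)

(** Induction on the size of the interval: if [y] does not cover [x], an element strictly between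
    them leaves a smaller interval whose ends still lie on different sides of [K]. *)
Lemma crossing_cover (d : Order.disp_t) (P : finPOrderType d) (K : {set P})
    (x y : P) :
  (x <= y)%O -> x \in K -> y \notin K ->
  exists u v, [/\ covers v u, (x <= u)%O, (v <= y)%O, u \in K & v \notin K].
Proof.
pose itv (x y : P) := [set w | (x <= w <= y)%O].
have [n] := ubnP #|itv x y|; elim: n x y => // n IHn x y.
rewrite ltnS => len xy xK yK.
have ltxy : (x < y)%O by rewrite lt_neqAle xy andbT; apply: contraNneq yK => <-.
case: (boolP (covers y x)) => [cxy | ].
  by exists x, y; rewrite !lexx.
rewrite /covers ltxy negbK => /existsP[z /andP[xz zy]].
have lt_itv (x' y' w : P) : (x <= x')%O -> (y' <= y)%O -> w \in itv x y ->
    w \notin itv x' y' -> #|itv x' y'| < n.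
  move=> xx' yy' wI wNI; apply: leq_trans len.
  apply: proper_card; apply/properP; split; last by exists w.
  apply/subsetP=> s; rewrite !inE => /andP[x's sy'].
  by rewrite (le_trans xx' x's) (le_trans sy' yy').
case: (boolP (z \in K)) => zK.
  have lt_zy : #|itv z y| < n.
    by apply: (lt_itv _ _ x); rewrite ?inE ?lexx ?(ltW xz) ?xy // (lt_geF xz).
  have [u [v [uv zu vy uK vK]]] := IHn z y lt_zy (ltW zy) zK yK.
  by exists u, v; split=> //; apply: le_trans (ltW xz) zu.
have lt_xz : #|itv x z| < n.
  by apply: (lt_itv _ _ y); rewrite ?inE ?lexx ?(ltW zy) ?xy // (lt_geF zy) andbF.
have [u [v [uv xu vz uK vK]]] := IHn x z lt_xz (ltW xz) xK zK.
by exists u, v; split=> //; apply: le_trans vz (ltW zy).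
Qed.

(** * Separations of order at most 2 *)

(* Here [s i] and [t j] say that [a_i] and [b_j] lie on one side of a
   separation of order at most 2, and [u i], [v i] that [a_i] is below the first
   and the second element of the separator. *)
Definition separates (I : finType) (s t u v : pred I) : Prop :=
  forall i j, i != j -> s i != t j -> u i && ~~ u j || v i && ~~ v j.

(** View [(u i, v i)] as a point of the Boolean square; a separated pair [i], [j] has the first
    point not below the second. So [p] is an antichain. Two elements of [p] fill the middle level,
    which forces [l] to the top and [r] to the bottom, where [q] fits neither. *)
Lemma separates_patterns (I : finType) (s t u v : pred I)
    (p := [set i | s i && ~~ t i]) (q := [set i | ~~ s i && t i])
    (l := [set i | s i && t i]) (r := [set i | ~~ s i && ~~ t i]) :
  separates s t u v ->
  [/\ #|p| <= 2, [|| #|p| == 0, #|r| == 0 | #|l| == 0]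
    & (1 < #|p|) && (0 < #|q|) ==> (#|l| + #|r| == 0)].
Proof.
move=> sep.
have sep' i j : s i != t j -> (s i != s j) || (t i != t j) ->
    u i && ~~ u j || v i && ~~ v j.
  move=> stij nij; apply: sep => //; apply: contraTneq nij => ->.
  by rewrite !eqxx.
split.
- rewrite leqNgt; apply/negP => /card_gt2P[i [j [k [[]]]]].
  rewrite !inE => /andP[si /negPf ti] /andP[sj /negPf tj] /andP[sk /negPf tk].
  move=> [nij njk nki].
  have nji : j != i by rewrite eq_sym.
  have nkj : k != j by rewrite eq_sym.
  have nik : i != k by rewrite eq_sym.
  move: (sep _ _ nij) (sep _ _ njk) (sep _ _ nki) (sep _ _ nji) (sep _ _ nkj)
    (sep _ _ nik).
  rewrite si ti sj tj sk tk /=.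
  move: (u i) (v i) (u j) (v j) (u k) (v k).
  by do 6![case=> /=]; do 6!move=> /(_ isT) // _.
- apply/negPn/negP; rewrite !negb_or -!lt0n => /and3P[].
  case/card_gt0P=> i + /card_gt0P[j + /card_gt0P[k]].
  rewrite !inE => /andP[si /negPf ti] /andP[/negPf sj /negPf tj] /andP[sk tk].
  move: (sep' i j) (sep' j k) (sep' k j) (sep' k i).
  rewrite si ti sj tj sk tk /=.
  move: (u i) (v i) (u j) (v j) (u k) (v k).
  by do 6![case=> /=]; do 4!move=> /(_ isT isT) // _.
apply/implyP=> /andP[/card_gt1P[i [j []]] + + nij /card_gt0P[k]].
rewrite !inE => /andP[si /negPf ti] /andP[sj /negPf tj] /andP[/negPf sk tk].
have nji : j != i by rewrite eq_sym.
apply/negPn/negP; rewrite -lt0n addn_gt0 => /orP[] /card_gt0P[h]; rewrite inE.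
  case/andP=> sh th.
  move: (sep _ _ nij) (sep _ _ nji) (sep' h i) (sep' h j) (sep' k h).
  rewrite si ti sj tj sk tk sh th /=.
  move: (u i) (v i) (u j) (v j) (u k) (v k) (u h) (v h).
  by do 8![case=> /=]; do 2!move=> /(_ isT) // _; do 3!move=> /(_ isT isT) // _.
case/andP=> /negPf sh /negPf th.
move: (sep _ _ nij) (sep _ _ nji) (sep' i h) (sep' j h) (sep' h k).
rewrite si ti sj tj sk tk sh th /=.
move: (u i) (v i) (u j) (v j) (u k) (v k) (u h) (v h).
by do 8![case=> /=]; do 2!move=> /(_ isT) // _; do 3!move=> /(_ isT isT) // _.
Qed.

(** Order reversal; it gives the bounds of [separates_patterns] with [p] and [q] exchanged. *)
Lemma separates_dual (I : finType) (s t u v : pred I) :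
  separates s t u v ->
  separates t s (fun i => ~~ u i) (fun i => ~~ v i).
Proof.
move=> sep i j nij tsij.
have := sep j i; rewrite eq_sym (eq_sym (s j)) => /(_ nij tsij).
by rewrite !negbK (andbC (~~ u i)) (andbC (~~ v i)).
Qed.

(** Only the sizes of the four classes matter: they sum to 5 and obey the bounds on patterns and
    their duals. *)
Lemma separates_touch_le2 (I : finType) (s t u v : pred I) :
  #|I| = 5 -> separates s t u v ->
  #|[set i | s i && t i]| <= 2 -> #|[set i | s i || t i]| <= 2.
Proof.
move=> cardI sep.
pose p := [set i | s i && ~~ t i]; pose q := [set i | ~~ s i && t i].
pose l := [set i | s i && t i]; pose r := [set i | ~~ s i && ~~ t i].
have card_sum (f : pred I) : #|[set i | f i]| = \sum_i f i.
  rewrite cardsE -sum1_card big_mkcond; apply: eq_bigr => i _.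
  by rewrite unfold_in; case: (f i).
have cardST : #|[set i | s i || t i]| = #|p| + #|q| + #|l|.
  rewrite /p /q /l !card_sum -!big_split; apply: eq_bigr => i _.
  by case: (s i); case: (t i).
have card_all : #|p| + #|q| + #|l| + #|r| = 5.
  rewrite -cardI /p /q /l /r !card_sum -!big_split -sum1_card.
  apply: eq_big => i // _.
  by case: (s i); case: (t i).
have := separates_patterns (separates_dual sep).
have -> : [set i | t i && ~~ s i] = q by apply/setP=> i; rewrite !inE andbC.
have -> : [set i | ~~ t i && s i] = p by apply/setP=> i; rewrite !inE andbC.
have -> : [set i | t i && s i] = l by apply/setP=> i; rewrite !inE andbC.
have -> : [set i | ~~ t i && ~~ s i] = r by apply/setP=> i; rewrite !inE andbC.
have := separates_patterns sep; rewrite -/p -/q -/l -/r => -[+ + +] [].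
rewrite cardST; lia.
Qed.

(** * Traces of a family of sets on a small set *)

Lemma card_le_nth (T : finType) (Y : {set T}) (n : nat) (x0 y : T) :
  #|Y| <= n -> y \in Y -> exists2 k, k < n & y = nth x0 (enum Y) k.
Proof.
move=> leYn yY; exists (index y (enum Y)); last by rewrite nth_index ?mem_enum.
by apply: leq_trans leYn; rewrite cardE index_mem mem_enum.
Qed.

Lemma separates_of_separator (I T : finType) (s t : pred I) (m : I -> {set T})
    (Y : {set T}) :
  #|Y| <= 2 ->
  (forall i j, i != j -> s i != t j -> ~~ (m i :&: Y \subset m j)) ->
  exists u v, separates s t u v.
Proof.
have [-> _ H|[x0 _] leY H] := set_0Vmem Y.
  exists xpred0, xpred0 => i j nij stij.
  by have := H i j nij stij; rewrite setI0 sub0set.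
(* If [Y] is a singleton, position 1 is the default [x0]; this is harmless, as only one disjunct has
   to hold. *)
exists (fun i => nth x0 (enum Y) 0 \in m i), (fun i => nth x0 (enum Y) 1 \in m i).
move=> i j nij stij; have /subsetPn[y] := H i j nij stij.
rewrite inE => /andP[ymi yY] ymj.
have [[|[|//]] _ eq_y] := card_le_nth x0 leY yY;
  by rewrite -eq_y ymi ymj ?orbT.
Qed.

(* Three chains cover the subsets of a 3-element set. *)
Lemma comparable_pair (I T : finType) (m : I -> {set T}) (Z : {set T}) :
  #|Z| <= 3 -> 3 < #|I| -> exists i j, i != j /\ m i :&: Z \subset m j.
Proof.
move=> leZ gtI.
have [x0 _|T0] := pickP T; last first.
  have /card_gt1P[i [j [_ _ nij]]] : 1 < #|I| by apply: leq_trans gtI.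
  by exists i, j; split=> //; apply/subsetP=> x; have := T0 x.
pose z k := nth x0 (enum Z) k.
(* Class 0 is the chain {}, 1, 12, 123; class 1 is 2, 23; class 2 is 3, 13. *)
pose chain (b1 b2 b3 : bool) : 'I_3 :=
  if b2 && ~~ b1 then @Ordinal 3 1 isT
  else if b3 && ~~ b2 then @Ordinal 3 2 isT else @Ordinal 3 0 isT.
pose g i := chain (z 0 \in m i) (z 1 \in m i) (z 2 \in m i).
have sub i j : (z 0 \in m i) <= (z 0 \in m j) -> (z 1 \in m i) <= (z 1 \in m j) ->
    (z 2 \in m i) <= (z 2 \in m j) -> m i :&: Z \subset m j.
  move=> h0 h1 h2; apply/subsetP=> x; rewrite inE => /andP[xmi xZ].
  move: h0 h1 h2; have [[|[|[|//]]] _ eq_x] := card_le_nth x0 leZ xZ;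
    by rewrite -/(z _) in eq_x; rewrite -eq_x xmi; case: (x \in m j).
have /injectivePn[i [j nij eq_g]] : ~~ injectiveb g.
  apply/negP=> /injectiveP/leq_card; rewrite card_ord leqNgt => /negP.
  exact.
suff : (m i :&: Z \subset m j) || (m j :&: Z \subset m i).
  by case/orP=> ?; [exists i, j | exists j, i; rewrite eq_sym].
have := (sub i j, sub j i); move: eq_g; rewrite /g.
move: (z 0 \in m i) (z 1 \in m i) (z 2 \in m i).
move: (z 0 \in m j) (z 1 \in m j) (z 2 \in m j).
by do 6![case]; move=> // _ [h1 h2]; first [by rewrite h1 | by rewrite h2 ?orbT].
Qed.

(* Otherwise take a comparable pair [i], [j] and [Y] witnessing its failure.
   Then [Y = {y, y'}] with [y] in [m i] and [m j] only, and [y'] in all the other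
   sets. As [Z] has at most one more element, these three sets form a chain on
   [Z]; its least one cannot be told apart from either of the other two. *)
Lemma inseparable_pair (I T : finType) (m : I -> {set T}) (Z : {set T}) :
  #|I| = 5 -> #|Z| <= 3 ->
  exists i j, [/\ i != j, m i :&: Z \subset m j & forall Y : {set T},
    Y \subset Z -> #|Y| <= 2 -> exists k, [/\ k != i, k != j &
      (m i :&: Y \subset m k) || (m k :&: Y \subset m j)]].
Proof.
move=> cardI leZ; apply: contrapT => noPair.
have pairY i j : i != j -> m i :&: Z \subset m j -> exists Y : {set T},
    [/\ Y \subset Z, #|Y| <= 2 & forall k, k != i -> k != j ->
      ~~ (m i :&: Y \subset m k) && ~~ (m k :&: Y \subset m j)].
  move=> nij sij; apply: contrapT => noY; apply: noPair; exists i, j.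
  split=> // Y YZ leY; apply: contrapT => nok; apply: noY; exists Y.
  split=> // k ki kj; rewrite -negb_or; apply/negP => sk.
  by apply: nok; exists k.
have [|i [j [nij sij]]] := comparable_pair m leZ; first by rewrite cardI.
have [Y [YZ leY HY]] := pairY i j nij sij.
pose O := ~: [set i; j].
have cardO : #|O| = 3.
  by have := cardsC [set i; j]; rewrite -/O cards2 nij cardI; lia.
have inO k : k \in O -> (k != i) && (k != j) by rewrite !inE negb_or.
have /card_gt0P[k0 k0O] : 0 < #|O| by rewrite cardO.
have /andP[k0i k0j] := inO _ k0O.
have /andP[/subsetPn[y] /[!inE] /andP[yi yY] yNk0 /subsetPn[y']] := HY k0 k0i k0j.
rewrite !inE => /andP[_ y'Y] y'Nj.
have subij x : x \in Y -> x \in m i -> x \in m j.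
  by move=> xY xi; apply: (subsetP sij); rewrite inE xi (subsetP YZ).
have yNy' : y != y' by apply: contraNneq y'Nj => <-; apply: subij.
have defY : Y = [set y; y'].
  apply/esym/eqP; rewrite eqEcard cards2 yNy' leY andbT.
  by apply/subsetP=> x; rewrite !inE => /orP[]/eqP->.
have memO k : k \in O -> (y \notin m k) && (y' \in m k).
  move=> /inO/andP[ki kj].
  have /andP[/subsetPn[w] + + /subsetPn[w']] := HY k ki kj.
  rewrite defY !inE => /andP[wi /orP[]/eqP eq_w]; last first.
    by rewrite -eq_w subij // ?eq_w in y'Nj.
  rewrite eq_w => -> /andP[w'k /orP[]/eqP eq_w']; last by rewrite -eq_w'.
  by rewrite eq_w' subij.
have leW : #|Z :\: Y| <= 1.
  have cardY : #|Y| = 2 by rewrite defY cards2 yNy'.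
  by rewrite cardsDS // cardY leq_subLR.
have [k1 k1O sub1] : exists2 k1, k1 \in O &
    forall k, k \in O -> m k1 :&: Z \subset m k.
  have subO k k' : k \in O -> k' \in O ->
      {subset m k :&: (Z :\: Y) <= m k'} -> m k :&: Z \subset m k'.
    move=> kO k'O subW; apply/subsetP=> x; rewrite inE => /andP[xk xZ].
    case: (boolP (x \in Y)) => [|xNY]; last by apply: subW; rewrite !inE xk xNY.
    have /andP[yNk _] := memO k kO; have /andP[_ y'k'] := memO k' k'O.
    by rewrite defY !inE => /orP[]/eqP eq_x; rewrite eq_x ?(negPf yNk) // in xk *.
  (* A set without the remaining element of [Z] is least; if all contain it, they agree on [Z]. *)
  case: (boolP [exists k in O, m k :&: (Z :\: Y) == set0]).
    case/exists_inP=> k1 k1O /eqP k1W; exists k1 => // k kO.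
    by apply: subO => // x; rewrite k1W inE.
  rewrite negb_exists_in => /forall_inP allW; exists k0 => // k kO.
  apply: subO => // x; rewrite inE => /andP[_ xW].
  have /set0Pn[w /setIP[wk wW]] := allW k kO.
  by rewrite (card_le1_eqP leW w x wW xW).
have /card_gt1P[k2 [k3 []]] : 1 < #|O :\ k1|.
  by move: cardO; rewrite (cardsD1 k1) k1O add1n => -[->].
case/setD1P=> k21 k2O /setD1P[k31 k3O] k23.
have [|Y' [Y'Z _ /(_ k3 k31)]] := pairY k1 k2 _ (sub1 k2 k2O).
  by rewrite eq_sym.
rewrite eq_sym k23 => /(_ isT)/andP[/negP[]].
exact: subset_trans (setIS _ Y'Z) (sub1 k3 k3O).
Qed.

(** * Components and their boundaries *)

Definition avoiding (V : finType) (e : rel V) (Z : {set V}) : rel V :=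
  [rel u v | [&& e u v, u \notin Z & v \notin Z]].

Definition component (V : finType) (e : rel V) (Z : {set V}) (v : V) : {set V} :=
  [set u | connect (avoiding e Z) v u].

Definition boundary (V : finType) (e : rel V) (Z : {set V}) (v : V) : {set V} :=
  [set z in Z | [exists u in component e Z v, e u z]].

Lemma component_refl (V : finType) (e : rel V) (Z : {set V}) (v : V) :
  v \in component e Z v.
Proof. by rewrite inE connect0. Qed.

Lemma component_disjoint (V : finType) (e : rel V) (Z : {set V}) (v : V) :
  v \notin Z -> [disjoint Z & component e Z v].
Proof.
move=> vZ; rewrite disjoint_sym disjoint_subset; apply/subsetP=> u.
rewrite !inE => /connectP[p + ->]; elim: p v vZ => //= w p IHp v vZ.
by case/andP=> /and3P[_ _ wZ] /IHp; apply.
Qed.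

Lemma component_connected (V : finType) (e : rel V) (Z : {set V}) (v : V) :
  symmetric e -> connected_in e (component e Z v).
Proof.
move=> symE; apply/connected_inP=> x y; rewrite !inE => vx vy.
have avoid_sym : connect_sym (avoiding e Z).
  apply: sym_connect_sym => u w.
  by rewrite /avoiding /= symE (andbC (u \notin Z)).
have := vy; rewrite (same_connect avoid_sym vx) => /connectP[p].
elim: p x vx => [|w p IHp] x vx /=; first by move=> _ ->; apply: connect0.
case/andP=> xw wp eq_y.
have vw : connect (avoiding e Z) v w by apply: connect_trans vx (connect1 xw).
apply: connect_trans (IHp w vw wp eq_y); apply: connect1.
by case/and3P: xw => /= -> _ _; rewrite !inE vx.
Qed.

Lemma component_boundary (V : finType) (e : rel V) (Z : {set V}) (v u w : V) :
  v \notin Z -> u \in component e Z v -> w \notin component e Z v -> e u w ->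
  w \in boundary e Z v.
Proof.
move=> vZ uK wK uw; rewrite inE; apply/andP; split; last first.
  by apply/exists_inP; exists u.
have uZ := disjointFl (component_disjoint e vZ) uK.
apply: contraNT wK => wZ; move: uK; rewrite !inE => /connect_trans; apply.
by apply: connect1; rewrite /avoiding /= uw wZ uZ.
Qed.

(* The boundary vertices and the component pairwise touch, so that a single bag
   meets all of them. *)
Lemma boundary_le2 (V : finType) (e : rel V) (D : tree_decomposition e)
    (t : td_node D) (v : V) :
  symmetric e -> (forall s, #|td_bag D s| <= 3) -> v \notin td_bag D t ->
  #|boundary e (td_bag D t) v| <= 2.
Proof.
move=> symE bag3 vt; set N := boundary e _ v; set K := component e (td_bag D t) v.
pose F := K |: [set [set z] | z in N].
have nset1 s z : z \in td_bag D s -> ~~ [disjoint td_bag D s & [set z]].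
  by move=> zs; rewrite disjoint_sym disjoints1 negbK.
have [|C C'|s Hs] := @tree_decomposition_helly _ _ D F.
- move=> C /setU1P[->|/imsetP[z _ ->]]; first exact: component_connected.
  exact: connected_in_set1.
- have touchK z : z \in N -> exists s,
      ~~ [disjoint td_bag D s & K] && ~~ [disjoint td_bag D s & [set z]].
    case/setIdP=> zt /exists_inP[u uK uz]; have [s /andP[us zs]] := td_edge D uz.
    by exists s; rewrite nset1 // andbT; apply/pred0Pn; exists u; rewrite /= us.
  case/setU1P=> [->|/imsetP[z zN ->]] /setU1P[->|/imsetP[z' zN' ->]].
  + have [s vs] := td_vertex D v; exists s; rewrite andbb.
    by apply/pred0Pn; exists v; rewrite /= vs component_refl.
  + exact: touchK.
  + by have [s] := touchK z zN; rewrite andbC; exists s.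
  + by exists t; case/setIdP: zN zN' => zt _ /setIdP[z't _]; rewrite !nset1.
have Ns : N \subset td_bag D s.
  apply/subsetP=> z zN; have := Hs [set z]; rewrite disjoint_sym disjoints1 negbK.
  by apply; rewrite setU1r // imset_f.
have /pred0Pn[u /andP[/= us uK]] := Hs K (setU11 _ _).
have uN : u \notin N.
  by rewrite inE (disjointFl (component_disjoint e vt) uK).
have := subset_leq_card (_ : u |: N \subset td_bag D s).
rewrite subUset sub1set us Ns cardsU1 uN add1n => /(_ isT) leN.
exact: leq_trans leN (bag3 s).
Qed.

(** * Cover graphs and the lower bound *)

Lemma cover_graph_sym (d : Order.disp_t) (P : finPOrderType d) :
  symmetric (cover_graph P).
Proof. by move=> x y; rewrite /cover_graph /= orbC. Qed.

(** The chain crosses by a cover, whose end outside [K] is a boundary vertex. If [x] is the outer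
    end, the crossing is taken from the complement of [K]. *)
Lemma boundary_between (d : Order.disp_t) (P : finPOrderType d) (Z : {set P})
    (v x y : P) (K := component (cover_graph P) Z v) :
  v \notin Z -> (x <= y)%O -> (x \in K) != (y \in K) ->
  exists z, [/\ z \in boundary (cover_graph P) Z v, (x <= z)%O & (z <= y)%O].
Proof.
move=> vZ xy; case: (boolP (x \in K)) => xK; case: (boolP (y \in K)) => yK //= _.
  have [u [w [cwu xu wy uK wK]]] := crossing_cover xy xK yK.
  exists w; split=> //.
    by apply: component_boundary uK wK _ => //; rewrite /cover_graph /= cwu orbT.
  by apply: le_trans xu _; case/andP: cwu => /ltW.
have [||u [w [cwu xu wy uK wK]]] := @crossing_cover _ _ (~: K) _ _ xy.
- by rewrite inE.
- by rewrite inE negbK.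
rewrite !inE ?negbK in uK wK; exists u; split=> //.
  apply: (@component_boundary _ _ _ _ w); rewrite ?inE //.
  by rewrite /cover_graph /= cwu.
by apply: le_trans wy; case/andP: cwu => /ltW.
Qed.

Theorem theorem5p2 (d : Order.disp_t) (P : finPOrderType d) :
  contains_subposet P (std_example 5) -> 3 <= treewidth (cover_graph P).
Proof.
case=> A [f [_ f_le]]; rewrite /treewidth; case: ex_minnP => k /asboolP[D wD] _.
rewrite leqNgt; apply/negP => lt_k3.
have bag3 s : #|td_bag D s| <= 3.
  apply: leq_trans (leq_bigmax (F := fun s => #|td_bag D s|) s) _.
  have le3 n : n.-1 < 3 -> n <= 3 by case: n.
  by apply: le3; rewrite -/(width D) wD.
pose a i : P := val (f (inl i)); pose b i : P := val (f (inr i)).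
have ab i j : (a i <= b j)%O = (i != j) by rewrite f_le le_eqVlt.
pose e := cover_graph P; have symE : symmetric e := @cover_graph_sym d P.
pose whole (C : {set P}) := [set i | (a i \in C) && (b i \in C)].
pose F := [set C : {set P} | connected_in e C && (2 < #|whole C|)].
have [|C C'|t Ht] := @tree_decomposition_helly _ _ D F.
- by move=> C; rewrite inE => /andP[].
- rewrite !inE => /andP[_ gtC] /andP[_ gtC'].
  have /set0Pn[i] : whole C :&: whole C' != set0.
    have le5 : #|whole C :|: whole C'| <= 5.
      by apply: leq_trans (max_card _) _; rewrite card_ord.
    have := cardsUI (whole C) (whole C').
    by rewrite -card_gt0; move: le5 gtC gtC'; clear; lia.
  rewrite !inE => /andP[/andP[aC _] /andP[aC' _]].
  have [s as_] := td_vertex D (a i); exists s.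
  by apply/andP; split; apply/pred0Pn; exists (a i); rewrite /= as_.
set Z := td_bag D t in Ht.
pose m i := [set z | (a i <= z)%O].
have [i [j [nij sij noY]]] := inseparable_pair m (card_ord 5) (bag3 t).
(* Otherwise [a i] is in [m j], so [a j <= a i <= b j]. *)
have aZ : a i \notin Z.
  apply/negP=> aZ; have := subsetP sij (a i).
  rewrite !inE lexx aZ => /(_ isT) aji.
  by have := le_trans aji (_ : (a i <= b j)%O); rewrite !ab nij eqxx => /(_ isT).
set K := component e Z (a i); set N := boundary e Z (a i).
have sepN i' j' : i' != j' -> (a i' \in K) != (b j' \in K) ->
    ~~ (m i' :&: N \subset m j').
  move=> nij' nK; have [|z [zN az zb]] := boundary_between aZ _ nK.
    by rewrite ab.
  apply/subsetPn; exists z; first by rewrite in_setI zN inE az.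
  by rewrite inE; apply/negP=> aj'z; have := le_trans aj'z zb; rewrite ab eqxx.
have NZ : N \subset Z by apply/subsetP=> z /setIdP[].
have leN : #|N| <= 2 by apply: boundary_le2.
(* Otherwise the relation [a i <= b j] crosses [N] at an element of [m i] outside [m j], against
   [sij]. *)
have bK : b j \in K.
  apply: contraTT sij => bK.
  have /sepN/(_ _) : i != j by [].
  rewrite component_refl (negPf bK) => /(_ isT); apply: contraNN.
  by apply: subset_trans; apply: setIS.
have [u [v sep]] := @separates_of_separator _ _
  (fun i => a i \in K) (fun i => b i \in K) m N leN sepN.
have := separates_touch_le2 (card_ord 5) sep.
rewrite -/(whole K) leqNgt.
(* [Z] meets all members of [F] but misses the connected set [K]. *)
have -> : 2 < #|whole K| = false.
  apply/negP => gtK; have := Ht K.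
  by rewrite inE component_connected // gtK component_disjoint // => /(_ isT).
move=> /(_ isT) touch2.
have [k' [ki kj]] := noY N NZ leN.
(* The indices [i] and [j] already touch [K], which leaves no room for [k']. *)
have /andP[/negPf akK /negPf bkK] : (a k' \notin K) && (b k' \notin K).
  rewrite -negb_or; apply: contraTN touch2 => touch_k; rewrite -ltnNge.
  apply/card_gt2P; exists i, j, k'.
  rewrite !(in_set (fun i => (a i \in K) || (b i \in K))) component_refl bK orbT.
  by rewrite touch_k nij (eq_sym j) kj ki.
have /negPf-> : ~~ (m i :&: N \subset m k').
  by apply: sepN; rewrite ?bkK ?component_refl // eq_sym.
by apply/negP; apply: sepN; rewrite ?akK ?bK.
Qed.
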